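(* Let $r>1$. Then $$\inf\left\{E_4[\mathbf{n}] : \mathbf{n}\in\mathcal{M}_4,\ Q[\mathbf{n}]=-1\right\}=-\infty.$$
   Context: Write $\mathbf{e}_3=(0,0,1)$ and let $\mathbb{S}^2\subset\mathbb{R}^3$ be the unit sphere. For $\mathbf{n}=(n_1,n_2,n_3):\mathbb{R}^2\to\mathbb{R}^3$ set $\nabla\times\mathbf{n}:=(\partial_1,\partial_2,0)\times\mathbf{n}=(\partial_2 n_3,\,-\partial_1 n_3,\,\partial_1 n_2-\partial_2 n_1)$. For $r>0$ and $\mathbf{n}:\mathbb{R}^2\to\mathbb{S}^2$ define $$E_4[\mathbf{n}]=D[\mathbf{n}]+rH[\mathbf{n}]+V_4[\mathbf{n}],$$ $$D[\mathbf{n}]=\frac12\int_{\mathbb{R}^2}|\nabla\mathbf{n}|^2dx,\quad H[\mathbf{n}]=\int_{\mathbb{R}^2}(\mathbf{n}-\mathbf{e}_3)\cdot(\nabla\times\mathbf{n})\,dx,\quad V_4[\mathbf{n}]=\frac18\int_{\mathbb{R}^2}|\mathbf{n}-\mathbf{e}_3|^4dx=\frac12\int_{\mathbb{R}^2}(1-n_3)^2dx.$$ Let $\mathcal{M}_4:=\{\mathbf{n}:\mathbb{R}^2\to\mathbb{S}^2 : D[\mathbf{n}]+V_4[\mathbf{n}]<\infty\}$. The functional $E_4$ is well defined on $\mathcal{M}_4$, and so is the integer-valued topological degree $$Q[\mathbf{n}]:=\frac1{4\pi}\int_{\mathbb{R}^2}\mathbf{n}\cdot(\partial_1\mathbf{n}\times\partial_2\mathbf{n})\,dx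 .$$ *)

(* Defs.v *)
From HB Require Import structures.
From mathcomp Require Import all_boot all_order all_algebra.
From mathcomp Require Import all_classical all_reals all_analysis.

Set Implicit Arguments.
Unset Strict Implicit.
Unset Printing Implicit Defensive.

Import Order.TTheory GRing.Theory Num.Theory.
Import numFieldNormedType.Exports.

Local Open Scope classical_set_scope.
Local Open Scope ring_scope.

Notation leb2 R := (@lebesgue_measure R \x @lebesgue_measure R)%E.

Section vec3.
Variable R : realType.
Implicit Types u v : 'rV[R]_3.

Definition vec3 (a b c : R) : 'rV[R]_3 := \row_(i < 3) [:: a; b; c]`_i.

Definition e3 : 'rV[R]_3 := vec3 0 0 1.

Definition dot u v : R := \sum_(i < 3) u 0 i * v 0 i.

(* The library norm on ['rV[R]_3] is the sup norm, hence this definition. *)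
Definition enorm u : R := Num.sqrt (dot u u).

Definition cross u v : 'rV[R]_3 :=
  vec3 (u 0 1 * v 0 2 - u 0 2 * v 0 1)
       (u 0 2 * v 0 0 - u 0 0 * v 0 2)
       (u 0 0 * v 0 1 - u 0 1 * v 0 0).

Definition sphere2 : set 'rV[R]_3 := [set v | enorm v = 1].

End vec3.
Arguments e3 {R}.

Section weak_derivative.
Variable R : realType.
Implicit Types (phi u g : R * R -> R) (i : 'I_2).

Definition dir i : R * R := if i == 0 then (1, 0) else (0, 1).

Definition iter_partial (s : seq 'I_2) phi : R * R -> R :=
  foldr (fun i psi => 'D_(dir i) psi) phi s.

Definition smooth phi := forall s : seq 'I_2,
  continuous (iter_partial s phi) /\
  forall i x, derivable (iter_partial s phi) x (dir i).

Definition test_function phi :=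
  smooth phi /\ compact (closure [set x | phi x != 0]).

(* The library's [locally_integrable] only covers functions on the line. *)
Definition loc_integrable2 u :=
  measurable_fun [set: R * R] u /\
  forall K : set (R * R), compact K ->
    (\int[leb2 R]_(x in K) `|u x|%:E < +oo)%E.

Definition weak_partial i u g :=
  [/\ loc_integrable2 u, loc_integrable2 g &
      forall phi, test_function phi ->
        \int[leb2 R]_(x in [set: R * R]) (u x * 'D_(dir i) phi x) =
        - \int[leb2 R]_(x in [set: R * R]) (g x * phi x)].

End weak_derivative.

(* A Borel map from the plane to 3-space together with Borel representatives of
   its two first-order weak derivatives. These are unique up to null sets, so
   every integral below depends only on the underlying map. *)
Record weak_map (R : realType) := WeakMap {
  wmap :> R * R -> 'rV[R]_3;
  wpartial : 'I_2 -> R * R -> 'rV[R]_3;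
  wpartialP : forall (i : 'I_2) (j : 'I_3),
    weak_partial i (fun x => wmap x 0 j) (fun x => wpartial i x 0 j)
}.

Section functionals.
Variable R : realType.
Implicit Type n : weak_map R.

Definition d1 n : R * R -> 'rV[R]_3 := wpartial n 0.
Definition d2 n : R * R -> 'rV[R]_3 := wpartial n 1.

Definition curl n (x : R * R) : 'rV[R]_3 :=
  vec3 (d2 n x 0 2) (- d1 n x 0 2) (d1 n x 0 1 - d2 n x 0 0).

(* The functionals take values in [\bar R]; on [M4] all the integrands below
   are integrable, so no indeterminate sum occurs there. *)
Definition dirichlet n : \bar R :=
  ((2^-1)%:E * \int[leb2 R]_(x in [set: R * R])
     (enorm (d1 n x) ^+ 2 + enorm (d2 n x) ^+ 2)%:E)%E.

Definition helicity n : \bar R :=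
  (\int[leb2 R]_(x in [set: R * R]) (dot (n x - e3) (curl n x))%:E)%E.

Definition V4 n : \bar R :=
  ((8^-1)%:E * \int[leb2 R]_(x in [set: R * R]) (enorm (n x - e3) ^+ 4)%:E)%E.

Definition E4 (r : R) n : \bar R :=
  (dirichlet n + r%:E * helicity n + V4 n)%E.

Definition degree n : \bar R :=
  (((4 * pi)^-1)%:E * \int[leb2 R]_(x in [set: R * R])
     (dot (n x) (cross (d1 n x) (d2 n x)))%:E)%E.

Definition M4 : set (weak_map R) :=
  [set n : weak_map R |
    (forall x, sphere2 (n x)) /\ (dirichlet n + V4 n < +oo)%E].

End functionals.

(* Main.v *)
Require Import Defs.
From HB Require Import structures.
From mathcomp Require Import all_boot all_order all_algebra.
From mathcomp Require Import all_classical all_reals all_analysis.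
From mathcomp Require Import measurable_realfun ring lra.

Set Implicit Arguments.
Unset Strict Implicit.

Import Order.TTheory GRing.Theory Num.Theory.
Import numFieldNormedType.Exports.

Local Open Scope classical_set_scope.
Local Open Scope ring_scope.

(** In the stereographic coordinate w = (u, v) of the sphere from the north
    pole, n = (2 u, 2 v, |w|^2 - 1) / (1 + |w|^2), every integrand of the
    problem becomes a polynomial in the derivatives of w divided by
    (1 + |w|^2)^2:
      |grad n|^2                 is    4 |grad w|^2 / (1 + |w|^2)^2,
      (n - e3) . curl n          is  - 4 (d1 v - d2 u) / (1 + |w|^2)^2,
      |n - e3|^4                 is   16 / (1 + |w|^2)^2,
      n . (d1 n x d2 n)          is  - 4 det (grad w) / (1 + |w|^2)^2.
    For a linear w the numerators are constant. The competitors are the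
    skyrmions given by w (x1, x2) = (- b x2, x1) with b > 0, which are
    elongated in the direction x2 as b tends to 0. They have
    1 + |w|^2 = 1 + x1^2 + b^2 x2^2, and the integral of
    (1 + x1^2 + b^2 x2^2)^-2 over the plane is pi / b. Hence the degree is
    - (4 b / (4 pi)) (pi / b) = -1 and
      E4 = (pi / b) (2 (1 + b^2) - 4 r (1 + b) + 2)
         = 2 pi (b - 2 (r - 1) / b - 2 r),
    which tends to -oo as b tends to 0 exactly because r > 1.

    The integral (lemma [integral_quad]) is computed by Tonelli's theorem and
    two explicit primitives. The remaining work is to show that the classical
    partial derivatives of these maps are weak ones: the product rule turns the
    claim into the vanishing of the integral of a partial derivative of a
    compactly supported function (lemma [integral_derive_plane_eq0]), which
    follows by integrating first in the direction of the derivative. *)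

(** * Borel measurability and integrability on the plane *)

(** Measurable sets of the plane are those of the product sigma-algebra; it
    contains the open sets because each one is a countable union of open boxes
    with rational corners. *)
Lemma open_measurable_plane (R : realType) (A : set (R * R)) :
  open A -> measurable A.
Proof.
move=> oA.
pose box (p : (rat * rat) * (rat * rat)) : set (R * R) :=
  `]ratr p.1.1, ratr p.1.2[ `*` `]ratr p.2.1, ratr p.2.2[.
have -> : A = \bigcup_(p in [set p | box p `<=` A]) box p.
  apply/seteqP; split=> [[x y] Axy|z [p]]; last exact.
  have [/= e e0 eA] := open_subball oA Axy.
  have rat_around (t : R) : exists p : rat * rat, ratr p.1 < t < ratr p.2 /\
      t - e / 2 < ratr p.1 /\ ratr p.2 < t + e / 2.
    have [p] := @rat_in_itvoo _ (t - e / 2) t ltac:(lra).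
    have [q] := @rat_in_itvoo _ t (t + e / 2) ltac:(lra).
    rewrite !in_itv /= => /andP[? ?] /andP[? ?]; exists (p, q).
    by split; [apply/andP|].
  have [p [/andP[p1 p2] [p3 p4]]] := rat_around x.
  have [q [/andP[q1 q2] [q3 q4]]] := rat_around y.
  exists (p, q); last by split => /=; rewrite in_itv /=; apply/andP.
  move=> [s t] [/=]; rewrite !in_itv /= => /andP[s1 s2] /andP[t1 t2].
  apply: (eA (e / 2)) => /=.
  - by rewrite sub0r normrN gtr0_norm; lra.
  - lra.
  - by split => /=; rewrite /ball /= ltr_norml; apply/andP; split; lra.
rewrite bigcup_mkcond; apply: countable_bigcupT_measurable => // p.
by case: ifPn => // _; apply: measurableX; exact: measurable_itv.
Qed.

Lemma continuous_measurable_plane (R : realType) (f : R * R -> R) :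
  continuous f -> measurable_fun setT f.
Proof.
move=> /continuousP cf.
apply: (measurability _ (RGenOpens.measurableE R)).
move=> _ [_ [a [c ->]] <-]; rewrite setTI; apply: open_measurable_plane.
exact/cf/interval_open.
Qed.

Lemma compact_measurable_plane (R : realType) (K : set (R * R)) :
  compact K -> measurable K.
Proof.
move=> /compact_closed cK; rewrite -[K]setCK; apply: measurableC.
by apply: open_measurable_plane; rewrite openC; apply/cK/norm_hausdorff.
Qed.

(** For continuous functions boundedness of the support suffices for
    integrability, and it passes to derivatives and products more directly than
    compactness of the closure of the support. *)
Definition bounded_support {R : realType} (f : R * R -> R) :=
  exists M : R, forall x, M < `|x| -> f x = 0.

Definition square {R : realType} (M : R) : set (R * R) :=
  `[- M, M] `*` `[- M, M].

Lemma squareE (R : realType) (M : R) x : square M x <-> `|x| <= M.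
Proof.
case: x => x y; rewrite /square /= !in_itv /= prod_normE /= ge_max !ler_norml.
by split=> [[-> ->]|/andP].
Qed.

Lemma compact_square (R : realType) (M : R) : compact (square M).
Proof. by apply: compact_setX; exact: segment_compact. Qed.

Lemma compact_sub_square (R : realType) (K : set (R * R)) :
  compact K -> exists M, K `<=` square M.
Proof.
move=> /compact_bounded [M [_ MK]]; exists (M + 1) => x Kx.
by apply/squareE/MK => //; rewrite ltrDl.
Qed.

Lemma square_fin_measure (R : realType) (M : R) : (leb2 R (square M) < +oo)%E.
Proof.
have fin : (@lebesgue_measure R `[(- M)%R, M] < +oo)%E.
  by rewrite lebesgue_measure_itv /=; case: ifP => _; rewrite ?ltry.
rewrite product_measure1E; [|exact: measurable_itv..].
by apply: lte_mul_pinfty => //; rewrite ge0_fin_numE.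
Qed.

Lemma continuous_compact_integrable_plane (R : realType) (f : R * R -> R) K :
  continuous f -> compact K -> (leb2 R).-integrable K (EFin \o f).
Proof.
move=> cf cK; have mK := compact_measurable_plane cK.
apply: measurable_bounded_integrable => //.
- have [M KM] := compact_sub_square cK.
  have mM := compact_measurable_plane (@compact_square R M).
  by rewrite (le_lt_trans _ (square_fin_measure M))// le_measure// inE.
- have mf : measurable_fun K f :=
    measurable_funTS (continuous_measurable_plane cf).
  exact: mf.
- have /compact_bounded[M [_ mrt]] := continuous_compact
    (continuous_subspaceT cf) cK.
  exists M; split=> [|t Mt x Kx]; first exact: num_real.
  by apply: (mrt t Mt); exists x.
Qed.

Lemma continuous_integrable_plane (R : realType) (f : R * R -> R) :
  continuous f -> bounded_support f -> (leb2 R).-integrable setT (EFin \o f).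
Proof.
move=> cf [M fM]; have cK := @compact_square R M.
have -> : EFin \o f = (EFin \o f) \_ (square M).
  apply/funext => x; rewrite patchE; case: ifPn => // /negP; rewrite inE => xM.
  by rewrite /= fM// ltNge; apply/negP => /squareE.
have mK := compact_measurable_plane cK.
apply: (iffLR (@integrable_mkcond _ _ _ (leb2 R) _ _ mK)).
exact: continuous_compact_integrable_plane.
Qed.

(** * Partial derivatives as derivatives along lines *)

Definition coord {R : realType} (i : 'I_2) (z : R * R) : R :=
  if i == 0 then z.1 else z.2.

(** The line through [z] in the direction [i], parametrised by the value of the
    moving coordinate. *)
Definition slice {R : realType} (i : 'I_2) (z : R * R) (t : R) : R * R :=
  if i == 0 then (t, z.2) else (z.1, t).

Lemma slice_coord (R : realType) i (z : R * R) : slice i z (coord i z) = z.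
Proof. by case: z => x y; rewrite /slice /coord; case: (i == 0). Qed.

Lemma slice_shift (R : realType) i (z : R * R) (h : R) :
  h *: dir R i + z = slice i z (h *: 1 + coord i z).
Proof.
rewrite /dir /slice /coord; case: (i == 0); rewrite [LHS]surjective_pairing /=.
- by rewrite scaler0 add0r.
- by rewrite scaler0 add0r.
Qed.

(** The two difference quotients are the same function of the increment, so that
    the one-variable calculus applies to the partial derivatives. *)
Lemma is_derive_slice (R : realType) i (f : R * R -> R) z d :
  is_derive z (dir R i) f d <-> is_derive (coord i z) 1 (f \o slice i z) d.
Proof.
have quotientE : (fun h : R => h^-1 *: ((f \o shift z) (h *: dir R i) - f z)) =
    (fun h : R => h^-1 *: (((f \o slice i z) \o shift (coord i z)) (h *: 1) -
                 (f \o slice i z) (coord i z))).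
  by apply/funext => h /=; rewrite slice_shift slice_coord.
by split=> -[df dfE]; split; move: df dfE; rewrite /derivable /derive quotientE.
Qed.

Lemma continuous_slice (R : realType) i (z : R * R) : continuous (slice i z).
Proof.
move=> t; rewrite /slice; case: (i == 0).
- exact: (cvg_pair (f := id) (g := cst z.2) cvg_id (cvg_cst _)).
- exact: (cvg_pair (f := cst z.1) (g := id) (cvg_cst _) cvg_id).
Qed.

(** * Integration by parts and weak derivatives *)

Lemma integral_derive1_eq0 (R : realType) (g dg : R -> R) (M : R) :
  (forall x : R, is_derive x 1 g (dg x)) -> continuous dg ->
  (forall x : R, M < `|x| -> g x = 0) ->
  (\int[lebesgue_measure]_x (dg x)%:E = 0)%E.
Proof.
move=> gdg cdg g0.
(* [N] lies strictly beyond [M], so [g] vanishes at both ends of [-N, N]. *)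
pose N := `|M| + 1.
have MN : M < N by rewrite /N; have := ler_norm M; lra.
have N0 : 0 < N by rewrite /N; have := normr_ge0 M; lra.
have dg0 x : M < `|x| -> dg x = 0.
  move=> Mx; have /@derive_val <- := gdg x.
  rewrite (@near_eq_derive _ _ _ g (cst 0)) ?derive_cst//.
  have : \forall t \near (x : R), M < `|t|.
    by have /cvgr_gt /(_ _ Mx) := @norm_continuous R R x.
  by apply: filterS => t /g0.
have -> : (fun x => (dg x)%:E) = (EFin \o dg) \_ `[- N, N].
  apply/funext => x; rewrite patchE; case: ifPn => // /negP.
  rewrite inE /= in_itv /= -ler_norml => /negP; rewrite -ltNge => Nx.
  by rewrite dg0//; exact: lt_trans Nx.
rewrite -integral_mkcond (@continuous_FTC2 _ _ g); first last.
- by move=> x _; rewrite derive1E; apply: derive_val.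
- have cg x : {for x, continuous g}.
    by apply: differentiable_continuous; apply/derivable1_diffP; case: (gdg x).
  split=> [x _||]; first by case: (gdg x).
  + exact/cvg_at_right_filter/cg.
  + exact/cvg_at_left_filter/cg.
- exact: continuous_subspaceT.
- by lra.
by rewrite !g0 ?subee// ?normrN gtr0_norm.
Qed.

(** By Fubini the variable of differentiation may be integrated first, and the
    inner integral vanishes on every line. *)
Lemma integral_derive_plane_eq0 (R : realType) i (f df : R * R -> R) :
  (forall x, is_derive x (dir R i) f (df x)) -> continuous df ->
  bounded_support f -> bounded_support df ->
  (\int[leb2 R]_x (df x)%:E = 0)%E.
Proof.
move=> fdf cdf [M fM] dfM.
have idf := continuous_integrable_plane cdf dfM.
have slice0 z : (\int[lebesgue_measure]_t (df (slice i z t))%:E = 0)%E.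
  apply: (@integral_derive1_eq0 _ (f \o slice i z) _ M).
  - move=> t; have /is_derive_slice := fdf (slice i z t).
    by rewrite /coord /slice /=; case: (i == 0).
  - move=> t; apply: (@continuous_comp _ _ _ (slice i z) df); last exact: cdf.
    exact: continuous_slice.
  - move=> t Mt; apply: fM; apply: lt_le_trans Mt _.
    by rewrite /slice; case: ifP => _; rewrite prod_normE /= le_max lexx ?orbT.
have [i0|i1] := eqVneq i 0.
- rewrite -(integral21_prod_meas1 idf) integral0_eq// => y _.
  by have := slice0 (0, y); rewrite /slice i0 eqxx.
- rewrite -(integral12_prod_meas1 idf) integral0_eq// => x _.
  by have := slice0 (x, 0); rewrite /slice (negbTE i1).
Qed.

Lemma test_function_bounded_support (R : realType) (phi : R * R -> R) :
  test_function phi -> bounded_support phi.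
Proof.
move=> [_ /compact_sub_square [M suppM]]; exists M => x Mx.
apply/eqP/negP => /negP phix0.
have /suppM/squareE : closure [set x | phi x != 0] x by exact: subset_closure.
by rewrite leNgt Mx.
Qed.

Lemma derive_bounded_support (R : realType) (f : R * R -> R) v :
  bounded_support f -> bounded_support ('D_v f).
Proof.
move=> [M fM]; exists M => x Mx.
rewrite (@near_eq_derive _ _ _ f (cst 0)) ?derive_cst//.
have : \forall t \near x, M < `|t|.
  by have /cvgr_gt /(_ _ Mx) := @norm_continuous R _ x.
by apply: filterS => t /fM.
Qed.

Lemma bounded_supportMr (R : realType) (u f : R * R -> R) :
  bounded_support f -> bounded_support (fun x => u x * f x).
Proof. by move=> [M fM]; exists M => x /fM ->; rewrite mulr0. Qed.

Lemma continuous_loc_integrable2 (R : realType) (u : R * R -> R) :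
  continuous u -> loc_integrable2 u.
Proof.
move=> cu; split=> [|K cK]; first exact: continuous_measurable_plane.
by have /integrableP[] := continuous_compact_integrable_plane cu cK.
Qed.

(** With [phi] a test function, [u * 'D_i phi + g * phi] is the derivative of
    [u * phi], whose integral vanishes. *)
Lemma C1_weak_partial (R : realType) (i : 'I_2) (u g : R * R -> R) :
  continuous u -> continuous g -> (forall x, is_derive x (dir R i) u (g x)) ->
  weak_partial i u g.
Proof.
move=> cu cg ug; split; [exact: continuous_loc_integrable2..|].
move=> phi tphi; have phiM := test_function_bounded_support tphi.
have [sphi _] := tphi; have [cphi dphi] := sphi [::].
have [cdphi _] := sphi [:: i].
have dphiM : bounded_support ('D_(dir R i) phi).
  exact: derive_bounded_support.
have cudphi : continuous (fun x => u x * 'D_(dir R i) phi x).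
  by move=> x; apply: cvgM; [exact: cu|exact: cdphi].
have cgphi : continuous (fun x => g x * phi x).
  by move=> x; apply: cvgM; [exact: cg|exact: cphi].
have iudphi := continuous_integrable_plane cudphi (bounded_supportMr u dphiM).
have igphi := continuous_integrable_plane cgphi (bounded_supportMr g phiM).
(* Both integrands are integrable: the two sides combine into one integral. *)
apply/eqP; rewrite -addr_eq0 -RintegralD//; apply/eqP.
rewrite /Rintegral (_ : (\int[_]_(x in _) _)%E = 0%E)//.
apply: (@integral_derive_plane_eq0 _ i (fun x => u x * phi x)).
- move=> x; have phix : is_derive x (dir R i) phi ('D_(dir R i) phi x).
    exact/derivableP/dphi.
  apply: is_derive_eq (is_deriveM (ug x) phix) _.
  by rewrite /GRing.scale /= mulrC [phi x * _]mulrC [_ * u x]mulrC.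
- by move=> x; apply: cvgD; [exact: cudphi|exact: cgphi].
- exact: bounded_supportMr.
- have [[M1 h1] [M2 h2]] := (dphiM, phiM); exists (Num.max M1 M2) => x.
  by rewrite gt_max => /andP[/h1 -> /h2 ->]; rewrite !mulr0 addr0.
Qed.

(** * The integral of (1 + x1^2 + b^2 x2^2)^-2 *)

(** Evenness reduces an improper integral over the line to the limit at +oo of a
    primitive that vanishes at 0. *)
Lemma ge0_even_integralT (R : realType) (f F : R -> R) (l : R) :
  (forall x, 0 <= f x) -> continuous f -> (forall x, f (- x) = f x) ->
  (forall x : R, is_derive x 1 F (f x)) -> F 0 = 0 -> F x @[x --> +oo] --> l ->
  (\int[lebesgue_measure]_x (f x)%:E = (2 * l)%:E)%E.
Proof.
move=> f0 cf evenf Ff F0 Fl.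
have cF x : {for x, continuous F}.
  by apply: differentiable_continuous; apply/derivable1_diffP; case: (Ff x).
rewrite (ge0_symfun_integralT f0 cf) => [|x /=]; last by rewrite evenf.
rewrite -set_itvcy (@ge0_continuous_FTC2y _ f F 0 l) ?F0 ?sube0 ?EFinM//.
- exact: continuous_subspaceT.
- by rewrite -{2}F0; apply/cvg_at_right_filter/cF.
- by move=> x _; rewrite derive1E; apply: derive_val.
Qed.

(** The primitive [F] is the one produced by the substitution
    y = (s / b) tan t. *)
Lemma integral_inv_sqr (R : realType) (s b : R) : 0 < s -> 0 < b ->
  (\int[lebesgue_measure]_y ((s ^+ 2 + b ^+ 2 * y ^+ 2) ^- 2)%:E =
   (pi / (2 * b) * s ^- 3)%:E)%E.
Proof.
move=> s0 b0; pose q y := s ^+ 2 + b ^+ 2 * y ^+ 2.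
have q0 y : 0 < q y by rewrite ltr_pwDl ?exprn_gt0// mulr_ge0 ?sqr_ge0.
have qd (y : R) : is_derive y 1 q (b ^+ 2 * (2 * y)).
  apply: is_derive_eq; rewrite /GRing.scale /=; ring.
have cq : continuous q.
  move=> y; apply: differentiable_continuous; apply/derivable1_diffP.
  by case: (qd y).
pose F y := (2 * s ^+ 2)^-1 * (y * (q y)^-1) +
  (2 * b * s ^+ 3)^-1 * atan (b / s * y).
transitivity ((2 * ((2 * b * s ^+ 3)^-1 * (pi / 2)))%:E); last first.
  by congr EFin; field; lra.
apply: (@ge0_even_integralT _ (fun y => q y ^- 2) F).
- by move=> y; rewrite invr_ge0 exprn_ge0// ltW.
- move=> y; apply: (@cvgV _ _ _ _ (fun y => q y ^+ 2)).
    by rewrite expf_neq0// gt_eqF.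
  rewrite expr2; apply: cvgM; exact: cq.
- by move=> y; rewrite /q sqrrN.
- move=> y; have qV := is_deriveV (lt0r_neq0 (q0 y)) (qd y).
  have dl : is_derive y 1 (fun y => b / s * y) (b / s).
    by apply: is_derive_eq; rewrite /GRing.scale /=; ring.
  have da := is_derive1_comp (is_derive1_atan (b / s * y)) dl.
  apply: is_derive_eq; rewrite /GRing.scale /=.
  have -> : 1 + (b / s * y) ^+ 2 = q y / s ^+ 2 by rewrite /q; field; lra.
  have : q y != 0 by rewrite gt_eqF.
  rewrite /q => ?; field; lra.
- by rewrite /F !mulr0 mul0r atan0 !mulr0 addr0.
- rewrite -[X in _ --> X]add0r; apply: cvgD.
    (* y / q y is squeezed between 0 and 1 / (b^2 y). *)
    rewrite -[X in _ --> X](mulr0 (2 * s ^+ 2)^-1); apply: cvgMr.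
    apply: (@squeeze_cvgr _ _ _ _ (cst 0) (fun y => (b ^+ 2)^-1 * y^-1)).
    + near=> y; have y0 : 0 < y by near: y; exact: nbhs_pinfty_gt.
      have yq : 0 <= y * (q y)^-1 by rewrite divr_ge0// ltW.
      rewrite yq -invfM ler_pdivrMr// ler_pdivlMl ?mulr_gt0 ?exprn_gt0// /q.
      by rewrite -mulrA -expr2 lerDr sqr_ge0.
    + exact: cvg_cst.
    + rewrite -[X in _ --> X](mulr0 (b ^+ 2)^-1); apply: cvgMr.
      by apply/gtr0_cvgV0; [exact: nbhs_pinfty_gt|exact: cvg_id].
  apply: cvgMr; apply: (cvg_comp _ _ _ (@cvgy_atan R)).
  by apply: gt0_cvgMry; [rewrite divr_gt0|exact: cvg_id].
Unshelve. all: by end_near. Qed.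

Lemma sqrt1Dsqr_gt0 (R : realType) (x : R) : 0 < Num.sqrt (1 + x ^+ 2).
Proof. by rewrite sqrtr_gt0 ltr_pwDl ?sqr_ge0. Qed.

Lemma is_derive_sqrt1Dsqr (R : realType) (x : R) :
  is_derive x 1 (fun x => Num.sqrt (1 + x ^+ 2)) (x / Num.sqrt (1 + x ^+ 2)).
Proof.
pose q (x : R) := 1 + x ^+ 2.
have qd : is_derive x 1 q (2 * x).
  by apply: is_derive_eq; rewrite /GRing.scale /=; ring.
have q0 : 0 < q x by rewrite ltr_pwDl ?sqr_ge0.
apply: (is_derive_eq (is_derive1_comp (is_derive1_sqrt q0) qd)).
by have := lt0r_neq0 (sqrt1Dsqr_gt0 x) => ?; field.
Qed.

Lemma continuous_invsqrt_cube (R : realType) :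
  continuous (fun x : R => Num.sqrt (1 + x ^+ 2) ^- 3).
Proof.
have cs : continuous (fun x : R => Num.sqrt (1 + x ^+ 2)).
  move=> x; apply: differentiable_continuous; apply/derivable1_diffP.
  by case: (is_derive_sqrt1Dsqr x).
move=> x; apply: (@cvgV _ _ _ _ (fun x : R => Num.sqrt (1 + x ^+ 2) ^+ 3)).
  by rewrite expf_neq0// gt_eqF// sqrt1Dsqr_gt0.
by rewrite exprS expr2; apply: cvgM; [exact: cs|apply: cvgM; exact: cs].
Qed.

(** A primitive is x / sqrt (1 + x^2), whose limit at +oo is 1. *)
Lemma integral_invsqrt_cube (R : realType) :
  (\int[lebesgue_measure]_x ((Num.sqrt (1 + x ^+ 2) ^- 3)%:E : \bar R) =
   2%:E)%E.
Proof.
pose s (x : R) := Num.sqrt (1 + x ^+ 2).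
have s0 x : 0 < s x := sqrt1Dsqr_gt0 x.
have sE x : s x ^+ 2 = 1 + x ^+ 2 by rewrite sqr_sqrtr// addr_ge0// sqr_ge0.
have sd (x : R) : is_derive x 1 s (x / s x) := is_derive_sqrt1Dsqr x.
transitivity ((2 * 1 : R)%:E); last by rewrite mulr1.
apply: (@ge0_even_integralT _ (fun x => s x ^- 3) (fun x => x * (s x)^-1)).
- by move=> x; rewrite invr_ge0 exprn_ge0// ltW.
- exact: continuous_invsqrt_cube.
- by move=> x; rewrite /s sqrrN.
- move=> x; have sV := is_deriveV (lt0r_neq0 (s0 x)) (sd x).
  apply: is_derive_eq; rewrite /GRing.scale /=.
  have sx : s x != 0 by rewrite gt_eqF.
  transitivity ((s x ^+ 2 - x ^+ 2) / s x ^+ 3); first by field.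
  by rewrite sE; field.
- by rewrite mul0r.
(* 1 - 1 / x is a lower bound because sqrt (1 + x^2) <= x + 1. *)
- apply: (@squeeze_cvgr _ _ _ _ (fun x => 1 - x^-1) (cst 1)).
  + near=> x; have x0 : 0 < x by near: x; exact: nbhs_pinfty_gt.
    have := sE x; have := s0 x; move: (s x) => t t0 tE.
    rewrite ler_pdivlMr// ler_pdivrMr// mul1r; apply/andP; split; last by nra.
    have xV : 0 < x^-1 by rewrite invr_gt0.
    have xVx : x * x^-1 = 1 by rewrite divff ?gt_eqF.
    have tx : t <= x + 1 by nra.
    by have : t * x^-1 >= 1; nra.
  + rewrite -[X in _ --> X]subr0; apply: cvgB; first exact: cvg_cst.
    by apply/gtr0_cvgV0; [exact: nbhs_pinfty_gt|exact: cvg_id].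
  + exact: cvg_cst.
Unshelve. all: by end_near. Qed.

(** This is 1 + |w|^2 for the stereographic coordinate w = (- b x2, x1). *)
Definition quad {R : realType} (b : R) (z : R * R) : R :=
  1 + z.1 ^+ 2 + b ^+ 2 * z.2 ^+ 2.

Lemma quad_gt0 (R : realType) (b : R) z : 0 < quad b z.
Proof.
by rewrite /quad -addrA ltr_pwDl// addr_ge0 ?sqr_ge0// mulr_ge0 ?sqr_ge0.
Qed.

Lemma continuous_fst_plane (R : realType) : continuous (fst : R * R -> R).
Proof. by move=> z; exact: cvg_fst. Qed.

Lemma continuous_snd_plane (R : realType) : continuous (snd : R * R -> R).
Proof. by move=> z; exact: cvg_snd. Qed.

Lemma continuous_quad (R : realType) (b : R) : continuous (quad b).
Proof.
move=> z; apply: cvgD; first apply: cvgD.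
- exact: cvg_cst.
- by rewrite expr2; apply: cvgM; exact: continuous_fst_plane.
- by rewrite expr2; apply: cvgMr; apply: cvgM; exact: continuous_snd_plane.
Qed.

Lemma continuous_quadV (R : realType) (b : R) :
  continuous (fun z => (quad b z)^-1).
Proof.
move=> z; apply: (@cvgV _ _ _ _ (quad b)); first by rewrite gt_eqF ?quad_gt0.
exact: continuous_quad.
Qed.

Lemma continuous_quadV2 (R : realType) (b : R) :
  continuous (fun z => quad b z ^- 2).
Proof.
move=> z; apply: (@cvgV _ _ _ _ (fun z => quad b z ^+ 2)).
  by rewrite expf_neq0// gt_eqF ?quad_gt0.
by rewrite expr2; apply: cvgM; exact: continuous_quad.
Qed.

(** The inner integral, in the second variable, is that of [integral_inv_sqr]
    with s = sqrt (1 + x1^2). *)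
Lemma integral_quad (R : realType) (b : R) : 0 < b ->
  (\int[leb2 R]_z (quad b z ^- 2)%:E = (pi / b)%:E)%E.
Proof.
move=> b0; have mq := continuous_measurable_plane (@continuous_quadV2 R b).
have q0 z : 0 <= quad b z ^- 2 by rewrite invr_ge0 exprn_ge0// ltW// quad_gt0.
rewrite [LHS](@fubini_tonelli1 _ _ _ _ R (@lebesgue_measure R)
  (@lebesgue_measure R) (fun z => (quad b z ^- 2)%:E)); first last.
- by move=> z; rewrite lee_fin.
- exact/measurable_EFinP.
rewrite /fubini_F.
transitivity (\int[lebesgue_measure]_x
    ((pi / (2 * b))%:E * (Num.sqrt (1 + x ^+ 2) ^- 3)%:E))%E.
  apply: eq_integral => x _; rewrite -EFinM -integral_inv_sqr//.
    apply: eq_integral => y _.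
    by rewrite /quad /= sqr_sqrtr// addr_ge0// sqr_ge0.
  by rewrite sqrtr_gt0 ltr_pwDl// sqr_ge0.
have ms := continuous_measurable_fun (@continuous_invsqrt_cube R).
rewrite ge0_integralZl//.
- by rewrite integral_invsqrt_cube -EFinM; congr EFin; field; lra.
- exact/measurable_EFinP.
- by rewrite lee_fin divr_ge0 ?pi_ge0// mulr_ge0// ltW.
Qed.

(** * The elongated skyrmion *)

Section vec3_coordinates.
Variable R : realType.
Implicit Types u v : 'rV[R]_3.

Lemma vec3E (a b c : R) :
  (vec3 a b c 0 0 = a) * (vec3 a b c 0 1 = b) * (vec3 a b c 0 2 = c).
Proof. by rewrite /vec3 !mxE. Qed.

Lemma dotE u v : dot u v = u 0 0 * v 0 0 + u 0 1 * v 0 1 + u 0 2 * v 0 2.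
Proof.
rewrite /dot !big_ord_recl big_ord0 addr0 addrA.
by congr (_ * _ + _ * _ + _ * _); congr (fun_of_matrix _ _ _); apply: val_inj.
Qed.

Lemma enorm_sqr u : enorm u ^+ 2 = dot u u.
Proof. by rewrite sqr_sqrtr// dotE !addr_ge0// -expr2 sqr_ge0. Qed.

Lemma weak_partial_vec3 i (f g h f' g' h' : R * R -> R) :
  weak_partial i f f' -> weak_partial i g g' -> weak_partial i h h' ->
  forall j, weak_partial i (fun z => vec3 (f z) (g z) (h z) 0 j)
                           (fun z => vec3 (f' z) (g' z) (h' z) 0 j).
Proof.
have coordE (a b c : R * R -> R) j :
    (fun z => vec3 (a z) (b z) (c z) 0 j) = nth (fun=> 0) [:: a; b; c] j.
  by apply/funext => z; rewrite mxE; case: j => [[|[|[|]]]].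
by move=> ff' gg' hh' j; rewrite !coordE; case: j => [[|[|[|]]]].
Qed.

End vec3_coordinates.

Section plane_calculus.
Variable R : realType.
Implicit Types f g : R * R -> R.

Lemma continuous_plane_cst (c : R) : continuous (fun _ : R * R => c).
Proof. by move=> z; exact: cvg_cst. Qed.

Lemma continuous_planeM f g :
  continuous f -> continuous g -> continuous (fun z => f z * g z).
Proof. by move=> cf cg z; apply: cvgM; [exact: cf|exact: cg]. Qed.

Lemma continuous_planeD f g :
  continuous f -> continuous g -> continuous (fun z => f z + g z).
Proof. by move=> cf cg z; apply: cvgD; [exact: cf|exact: cg]. Qed.

Lemma continuous_planeN f : continuous f -> continuous (fun z => - f z).
Proof. by move=> cf z; apply: cvgN; exact: cf. Qed.

Lemma is_derive_fst i (z : R * R) : is_derive z (dir R i) fst (dir R i).1.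
Proof.
apply/is_derive_slice; rewrite /dir /slice; case: (i == 0).
- exact: is_derive_id.
- exact: is_derive_cst.
Qed.

Lemma is_derive_snd i (z : R * R) : is_derive z (dir R i) snd (dir R i).2.
Proof.
apply/is_derive_slice; rewrite /dir /slice; case: (i == 0).
- exact: is_derive_cst.
- exact: is_derive_id.
Qed.

End plane_calculus.

(** Syntax-directed: the factors and summands are read off the goal, so that no
    unification of functions takes place. *)
Ltac plane_continuity :=
  repeat lazymatch goal with
  | |- continuous (fun _ => ?c) => exact: continuous_plane_cst
  | |- continuous (fun z => @?f z + @?g z) => apply: (@continuous_planeD _ f g)
  | |- continuous (fun z => @?f z * @?g z) => apply: (@continuous_planeM _ f g)
  | |- continuous (fun z => - @?f z) => apply: (@continuous_planeN _ f)
  | |- continuous (fun z => z.1) => exact: continuous_fst_plane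
  | |- continuous (fun z => z.2) => exact: continuous_snd_plane
  | |- continuous (fun z => (quad _ z)^-1) => exact: continuous_quadV
  end.

Section skyrmion.
Variables (R : realType) (b : R).

(** The inverse stereographic image of w = (- b x2, x1), by the formula
    n = (2 u, 2 v, |w|^2 - 1) / (1 + |w|^2). *)
Definition skyrmion (z : R * R) : 'rV[R]_3 :=
  vec3 (- 2 * b * (z.2 * (quad b z)^-1)) (2 * (z.1 * (quad b z)^-1))
       (1 - 2 * (quad b z)^-1).

(** The partial derivatives are written uniformly in the direction of
    differentiation, whose components single out the relevant terms; one
    application of the product rule then covers both of them. *)
Definition quadV_partial (i : 'I_2) (z : R * R) : R :=
  - (2 * (z.1 * (dir R i).1 + b * b * (z.2 * (dir R i).2))) *
  ((quad b z)^-1 * (quad b z)^-1).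

Definition skyrmion_partial (i : 'I_2) (z : R * R) : 'rV[R]_3 :=
  vec3 (- 2 * b * ((dir R i).2 * (quad b z)^-1 + z.2 * quadV_partial i z))
       (2 * ((dir R i).1 * (quad b z)^-1 + z.1 * quadV_partial i z))
       (- 2 * quadV_partial i z).

Lemma is_derive_quadV i z :
  is_derive z (dir R i) (fun z => (quad b z)^-1) (quadV_partial i z).
Proof.
apply/is_derive_slice.
have dq : is_derive (coord i z) 1 (quad b \o slice i z)
    (2 * (z.1 * (dir R i).1 + b * b * (z.2 * (dir R i).2))).
  apply/is_derive_slice; have d1 := is_derive_fst i z.
  have d2 := is_derive_snd i z.
  by apply: is_derive_eq; rewrite /GRing.scale /=; ring.
have q0 : (quad b \o slice i z) (coord i z) != 0 by rewrite gt_eqF ?quad_gt0.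
apply: is_derive_eq (is_deriveV q0 dq) _.
by rewrite /= slice_coord /quadV_partial -exprVn /GRing.scale /=; ring.
Qed.

Lemma skyrmion_weak_partial i (j : 'I_3) :
  weak_partial i (fun z => skyrmion z 0 j) (fun z => skyrmion_partial i z 0 j).
Proof.
apply: weak_partial_vec3; apply: C1_weak_partial => [||z];
  rewrite /quadV_partial; try by plane_continuity.
all: have d1 := is_derive_fst i z; have d2 := is_derive_snd i z;
  have dV := is_derive_quadV i z.
all: apply: is_derive_eq; rewrite /quadV_partial /GRing.scale /=; ring.
Qed.

Definition skyrmion_map : weak_map R := WeakMap skyrmion_weak_partial.

End skyrmion.

(** * Energy and degree of the elongated skyrmion *)

Section skyrmion_energy.
Variables (R : realType) (b : R) (b0 : 0 < b).
Let n := skyrmion_map b.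

Let dirE : (dir R 0 = (1, 0)) * (dir R 1 = (0, 1)).
Proof. by []. Qed.

Let coordsE := (enorm_sqr, dotE, mxE, vec3E, dirE).

Lemma integral_density (f : R * R -> R) (c : R) :
  (forall z, f z = c * quad b z ^- 2) ->
  (\int[leb2 R]_z (f z)%:E = (c * (pi / b))%:E)%E.
Proof.
move=> fE; have mq := continuous_measurable_plane (@continuous_quadV2 R b).
have iq : (leb2 R).-integrable setT (EFin \o (fun z => quad b z ^- 2)).
  apply/integrableP; split; first exact/measurable_EFinP.
  have -> : (\int[leb2 R]_z `|(quad b z ^- 2)%:E| = (pi / b)%:E)%E;
    last exact: ltry.
  rewrite -integral_quad//; apply: eq_integral => z _.
  by rewrite /= ger0_norm// invr_ge0 exprn_ge0// ltW// quad_gt0.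
rewrite EFinM -integral_quad// -integralZl//.
by apply: eq_integral => z _; rewrite fE EFinM.
Qed.

(* The form in which the denominators come out of normalisation. *)
Let quad_neq0 (x y : R) : 1 + x ^+ 2 + (b * y) ^+ 2 != 0.
Proof. by rewrite exprMn gt_eqF// (quad_gt0 b (x, y)). Qed.

Lemma skyrmion_sphere z : sphere2 (n z).
Proof.
case: z => x y.
rewrite /sphere2 /= /enorm [dot _ _](_ : _ = 1) ?sqrtr1//.
rewrite !coordsE /skyrmion_map /=; by rewrite /quad /=; field; exact: quad_neq0.
Qed.

Lemma dirichlet_skyrmion : dirichlet n = (2 * (1 + b ^+ 2) * (pi / b))%:E.
Proof.
rewrite /dirichlet (@integral_density _ (4 * (1 + b ^+ 2))) => [|[x y]].
  by rewrite -EFinM; congr EFin; field; exact: lt0r_neq0.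
rewrite !coordsE /= /quadV_partial !coordsE /=.
by rewrite /quad /=; field; exact: quad_neq0.
Qed.

Lemma helicity_skyrmion : helicity n = (- 4 * (1 + b) * (pi / b))%:E.
Proof.
rewrite /helicity (@integral_density _ (- 4 * (1 + b))) => // -[x y].
rewrite !coordsE /= /quadV_partial !coordsE /=.
by rewrite /quad /=; field; exact: quad_neq0.
Qed.

Lemma V4_skyrmion : V4 n = (2 * (pi / b))%:E.
Proof.
rewrite /V4 (@integral_density _ 16) => [|[x y]].
  by rewrite -EFinM; congr EFin; field; exact: lt0r_neq0.
rewrite (_ : 4 = 2 * 2)%N// exprM !coordsE /=.
by rewrite /quad /=; field; exact: quad_neq0.
Qed.

Lemma degree_skyrmion : degree n = (-1)%:E.
Proof.
rewrite /degree (@integral_density _ (- 4 * b)) => [|[x y]].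
  (* [pi] is generalised so that normalisation does not unfold it. *)
  rewrite -EFinM; congr EFin; have := lt0r_neq0 (pi_gt0 R).
  by move: (pi : R) => p p0; field; rewrite p0 lt0r_neq0.
rewrite !coordsE /= /quadV_partial !coordsE /=.
by rewrite /quad /=; field; exact: quad_neq0.
Qed.

Lemma skyrmion_M4 : M4 n.
Proof.
split; first exact: skyrmion_sphere.
by rewrite dirichlet_skyrmion V4_skyrmion -EFinD ltry.
Qed.

Lemma E4_skyrmion r :
  E4 r n = (2 * pi * (b - 2 * (r - 1) / b - 2 * r))%:E.
Proof.
rewrite /E4 dirichlet_skyrmion helicity_skyrmion V4_skyrmion -EFinM -!EFinD.
by congr EFin; field; exact: lt0r_neq0.
Qed.

End skyrmion_energy.

Unset Implicit Arguments.

Theorem theorem2 (R : realType) (r : R) (hr : 1 < r) :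
  ereal_inf [set E4 r n | n in [set n : weak_map R | M4 n /\ degree n = (-1)%:E]] = -oo%E.
Proof.
apply: eq_ninfty => A.
(* The choice of [c] makes [b <= 1] and [(r - 1) / b = c >= `|A|], so that the
   energy is at most [- 2 * pi * c <= A]. *)
pose c := r - 1 + `|A| + 1; pose b := (r - 1) / c.
have A0 := normr_ge0 A.
have c0 : 0 < c by rewrite /c; lra.
have b0 : 0 < b by rewrite divr_gt0//; lra.
have b1 : b <= 1 by rewrite ler_pdivrMr// /c; lra.
apply: (@le_trans _ _ (E4 r (skyrmion_map b))).
  apply: ereal_inf_lbound; exists (skyrmion_map b) => //.
  by split; [exact: skyrmion_M4|exact: degree_skyrmion].
have bc : (r - 1) / b = c by rewrite /b; field; lra.
rewrite E4_skyrmion// lee_fin -[2 * (r - 1) / b]mulrA bc.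
have pi2 := pi_ge2 R; have := ler_norm (- A); rewrite normrN => ?.
have : b - 2 * c - 2 * r <= - c by rewrite /c; lra.
rewrite /c in c0 *; nra.
Qed.
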